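(* Let $j_n\in[n]$ and $t_n\in\mathbb{N}$ be sequences. Assume that $\gamma=\lim_{n\to\infty}j_n/n$ exists and that $$\lim_{n\to\infty}\frac{n^2}{t_n j_n(n-j_n)}=\lim_{n\to\infty}\frac{t_n}{j_n(n-j_n)}=0.$$ Then $$\mathbb{P}^n_{id}\left(\left.\frac{\Pi_{t_n}(j_n)-j_n}{\sqrt{2t_n\lambda_n}}\in\cdot\,\right|\,j_n\in A^{t_n}\right)\Longrightarrow \mathbb{P}(N(0,1)\in\cdot),$$ where $\lambda_n=j_n/n$ if $\gamma=0$, $\lambda_n=(n-j_n)/n$ if $\gamma=1$, and $\lambda_n=\gamma(1-\gamma)$ if $\gamma\in(0,1)$.
   Context: The random-to-random insertions shuffle on a deck of $n$ cards numbered $1,\dots,n$: at each step a card is chosen uniformly at random, removed, and reinserted at a uniformly random position. Orderings are identified with $\sigma\in S_n$, $\sigma(j)$ being the position of card $j$; $\Pi_t$ is the induced random walk on $S_n$ and $\mathbb{P}^n_{id}$ its law started at the identity, so $\Pi_t(j)$ is the position of card $j$ after $t$ shuffles. $A^t=A^{n,t}$ denotes the (random) set of cards that have not been chosen for removal in the first $t$ shuffles. $[n]=\{1,\dots,n\}$, $\Rightarrow$ denotes weak convergence and $N(0,1)$ a standard normal random variable. *)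

(* Defs.v *)
From HB Require Import structures.
From mathcomp Require Import all_boot all_order all_algebra.
From mathcomp Require Import all_classical all_reals all_analysis.
Set Implicit Arguments. Unset Strict Implicit. Unset Printing Implicit Defensive.
Import Order.TTheory GRing.Theory Num.Theory.
Local Open Scope ring_scope.

(* Cards and positions are 0-indexed naturals 0..n-1 (card c of the paper is
   card c-1 here, position p of the paper is position p-1 here).
   A deck state is the map  card |-> position  (sigma(j) = position of card j). *)

(* One random-to-random step: card c is removed from the deck and reinserted
   so that it ends at position p (0 <= p < n) of the new deck. *)
Definition rtr_step (c p : nat) (pos : nat -> nat) : nat -> nat :=
  fun x =>
    if x == c then p
    else
      let r := pos x in
      let r' := if (pos c < r)%N then r.-1 else r in  (* after removal *)
      if (p <= r')%N then r'.+1 else r'.               (* after insertion *)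

Definition rtr_run (s : seq (nat * nat)) : nat -> nat :=
  foldl (fun pos cp => rtr_step cp.1 cp.2 pos) (fun x => x) s.

(* Sample space for t shuffles of n cards: at step i (i < t) the pair
   (card chosen, insertion position), both uniform on 'I_n and independent,
   i.e. the uniform distribution on this finite type. *)
Definition outcomes (n t : nat) := {ffun 'I_t -> 'I_n * 'I_n}.

Definition moves n t (w : outcomes n t) : seq (nat * nat) :=
  [seq (val (w i).1, val (w i).2) | i <- enum 'I_t].

Definition Pi n t (w : outcomes n t) (c : nat) : nat := rtr_run (moves w) c.

Definition notChosen n t (w : outcomes n t) (c : nat) : bool :=
  [forall i, val (w i).1 != c].

Definition cond_exp_unif {R : realType} (T : finType) (C : pred T) (X : T -> R) : R :=
  (\sum_(w | C w) X w) / #|C|%:R.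

(* Main.v *)
(* Given that card j is never chosen, its position performs a nearest-neighbour
   Markov chain on {0, ..., n-1} started at x0 = j-1; the steps +1 and -1 have
   probabilities (n-1-x)(x+1)/(n(n-1)) and x(n-x)/(n(n-1)).  Write d(x) = O(1/n)
   for the mean increment and q(x) for its mean square;
   q(x) = 2 j(n-j)/n^2 + O((1 + |x - x0|)/n).  The trigonometric functions are
   almost eigenfunctions of the transition operator P: with theta = u/s,
   s = sqrt(2 t lambda) and h(x) = cos(theta (x - x0) + v),
     P h (x) = h(x) (1 - q(x) (1 - cos theta))
               - d(x) sin theta sin(theta (x - x0) + v),
   so that P h = exp(-u^2/(2t)) h up to an error whose sum along t steps is
   controlled by the bound E(X_k - x0)^2 <= 2 s^2 and tends to 0.  Hence
   E cos(u W + v) --> exp(-u^2/2) cos v for the rescaled displacement W, which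
   is the corresponding Gaussian integral.

   From these test functions to bounded continuous f: on [-L, L] the function f
   is uniformly close to a Bernstein polynomial in sin(x/L).  That trigonometric
   polynomial is bounded on the whole line by the bound of f, so the error
   elsewhere is at most a small multiple of x^2, and second moments are bounded. *)
Require Import Defs.
From HB Require Import structures.
From mathcomp Require Import all_boot all_order all_algebra.
From mathcomp Require Import all_classical all_reals all_analysis.
From mathcomp Require Import measurable_realfun zify ring lra.
Set Implicit Arguments. Unset Strict Implicit. Unset Printing Implicit Defensive.
Import Order.TTheory GRing.Theory Num.Theory numFieldNormedType.Exports.
Local Open Scope classical_set_scope.
Local Open Scope ring_scope.

(** * The position of a card that is never chosen *)

(** Decks are functions on all of [nat], so they are required to be permutations only on the first
    [n] numbers. *)
Definition deck_perm (n : nat) (pos : nat -> nat) : Prop :=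
  (forall x, (x < n)%N -> (pos x < n)%N) /\
  (forall x y, (x < n)%N -> (y < n)%N -> pos x = pos y -> x = y).

Lemma deck_perm_step n c p pos : (c < n)%N -> (p < n)%N ->
  deck_perm n pos -> deck_perm n (rtr_step c p pos).
Proof.
move=> cn pn [posn posI]; split=> [x xn|x y xn yn]; rewrite /rtr_step/=.
  have := posn _ xn; have := posn _ cn.
  have [//|/eqP xc] := boolP (x == c).
  have : pos x <> pos c by move=> e; apply: xc; exact: posI.
  by case: ifP => ? /=; case: ifP => ? /=; lia.
have posI' a b : (a < n)%N -> (b < n)%N -> (a == b) || (pos a != pos b).
  by move=> an bn; have [//|/eqP ab] := eqVneq a b; apply/eqP => /(posI _ _ an bn).
have := posI' _ _ xn yn; have := posI' _ _ xn cn; have := posI' _ _ yn cn.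
have := posn _ xn; have := posn _ yn; have := posn _ cn.
case: (ltnP (pos c) (pos x)) => ?; case: (ltnP (pos c) (pos y)) => ?;
by do 4?[case: ifP => ?]; lia.
Qed.

(* Transition operator of the position of a card conditioned on not being chosen;
   at x = 0 the junk value x.-1 = 0 gets weight 0. *)
Definition stepop {R : realType} (n : nat) (g : nat -> R) (x : nat) : R :=
  g x
  + x%:R * (n%:R - x%:R) / (n%:R * (n%:R - 1)) * (g x.-1 - g x)
  + (n%:R - 1 - x%:R) * (x%:R + 1) / (n%:R * (n%:R - 1)) * (g x.+1 - g x).

Lemma sum_ord_leq {R : realType} (n r : nat) (a b : R) : (r <= n)%N ->
  \sum_(p < n) (if (p < r)%N then a else b) = r%:R * a + (n%:R - r%:R) * b.
Proof.
move=> rn; rewrite -(big_mkord xpredT (fun p => if (p < r)%N then a else b)).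
rewrite (big_cat_nat (n := r))//=; congr (_ + _).
  rewrite big_nat (eq_bigr (fun=> a)) -?big_nat ?sumr_const_nat ?subn0 ?mulr_natl//.
  by move=> i /andP[_ ->].
rewrite big_nat (eq_bigr (fun=> b)) -?big_nat ?sumr_const_nat -?natrB ?mulr_natl//.
by move=> i /andP[ri _]; rewrite ltnNge ri.
Qed.

(** Only the position of the removed card relative to [c] matters, so the sum over cards is
    reindexed by positions: [r] of them lie below that of [c] and [n - 1 - r] above. *)
Lemma sum_rtr_step {R : realType} (n c : nat) pos (g : nat -> R) :
  (1 < n)%N -> (c < n)%N -> deck_perm n pos ->
  \sum_(a : 'I_n | val a != c) \sum_(p : 'I_n) g (rtr_step a p pos c) =
  n%:R * (n%:R - 1) * stepop n g (pos c).
Proof.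
move=> n1 cn [posn posI]; set r := pos c; have rn : (r < n)%N by exact: posn.
pose h (a : 'I_n) : 'I_n := Ordinal (posn a (ltn_ord a)).
have hI : injective h.
  by move=> a b [] /posI e; apply/val_inj/e.
(* [A] and [B] sum over the insertion positions when the removed card lies below, respectively
   above, [r]. Removal takes [c] to [r.-1] or leaves it at [r]; insertion at or below that place
   pushes it up by one. *)
pose A : R := r%:R * g r + (n%:R - r%:R) * g r.-1.
pose B : R := r.+1%:R * g r.+1 + (n%:R - r.+1%:R) * g r.
transitivity (\sum_(b : 'I_n | b != Ordinal rn) (if (b < r)%N then A else B)).
  rewrite [RHS](reindex_inj hI)/=; apply: eq_big => [a|a ac].
    by rewrite -(inj_eq val_inj)/=; congr negb; apply/eqP/eqP => [->//|/posI ->].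
  have ra : pos a != r.
    by apply: contra ac => /eqP /posI e; apply/eqP/e.
  have ca : (c == val a) = false by rewrite eq_sym (negbTE ac).
  under eq_bigr do rewrite /rtr_step ca -/r.
  rewrite /=; case: ifP => par.
    have r0 : (0 < r)%N by lia.
    under eq_bigr => p _.
      rewrite (_ : (p <= r.-1)%N = (p < r)%N); last by lia.
      rewrite fun_if prednK//; over.
    by rewrite sum_ord_leq// ltnW.
  under eq_bigr => p _ do rewrite fun_if -ltnS.
  by rewrite sum_ord_leq.
(* [sum_ord_leq] also counts the position of [c] itself, with value [B]; that term is subtracted. *)
have := sum_ord_leq A B (ltnW rn); rewrite (bigD1 (Ordinal rn))//= ltnn.
move=> /(canRL (addKr _)) ->; rewrite /stepop /A /B -natr1.
have : (n%:R : R) != 0 by rewrite pnatr_eq0; lia.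
have : (n%:R - 1 : R) != 0 by rewrite subr_eq0 (eqr_nat R n 1); lia.
by move=> ? ?; field; apply/andP.
Qed.

(** The first shuffle is split off, not the last, because [foldl] consumes the moves from the
    head. *)
Lemma sum_outcomesS {R : realType} (n t : nat) (F : outcomes n t.+1 -> R) :
  \sum_(w : outcomes n t.+1) F w =
  \sum_(ap : 'I_n * 'I_n) \sum_(w : outcomes n t)
    F [ffun i => if unlift ord0 i is Some k then w k else ap].
Proof.
rewrite pair_big/=.
rewrite (reindex (fun apw : ('I_n * 'I_n) * outcomes n t =>
  [ffun i => if unlift ord0 i is Some k then apw.2 k else apw.1] : outcomes n t.+1))//=.
exists (fun w : outcomes n t.+1 => (w ord0, [ffun k => w (lift ord0 k)])).
- move=> [ap w] _ /=; congr pair; first by rewrite ffunE unlift_none.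
  by apply/ffunP => k; rewrite !ffunE liftK.
- move=> w _; apply/ffunP => i; rewrite ffunE /=.
  by case: unliftP => [k ->|->//]; rewrite ffunE.
Qed.

(** The starting deck is arbitrary because the induction resumes from the deck reached after one
    shuffle. Each shuffle sparing [c] has [n * (n - 1)] choices, whence the power. *)
Lemma sum_rtr_run {R : realType} (n t c : nat) pos (g : nat -> R) :
  (1 < n)%N -> (c < n)%N -> deck_perm n pos ->
  \sum_(w : outcomes n t | notChosen w c)
    g (foldl (fun pos cp => rtr_step cp.1 cp.2 pos) pos (moves w) c) =
  (n%:R * (n%:R - 1)) ^+ t * iter t (stepop n) g (pos c).
Proof.
move=> n1 cn; elim: t pos => [|t IH] pos posP.
  rewrite expr0 mul1r/= (big_pred1 [ffun i => (Ordinal cn, Ordinal cn)]).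
    by rewrite /moves (size0nil (size_enum_ord 0)).
  move=> w /=; transitivity true; first by apply/forallP => -[].
  by apply/esym/eqP/ffunP => -[].
rewrite big_mkcond sum_outcomesS.
transitivity (\sum_(ap : 'I_n * 'I_n | val ap.1 != c)
   (n%:R * (n%:R - 1)) ^+ t * iter t (stepop n) g (rtr_step ap.1 ap.2 pos c)).
  rewrite [RHS]big_mkcond; apply: eq_bigr => -[a p] _ /=.
  have cE (w : outcomes n t) : notChosen
      [ffun i => if unlift ord0 i is Some k then w k else (a, p)] c
      = (val a != c) && notChosen w c.
    apply/forallP/andP => [H|[ac /forallP H] i].
      split; first by have := H ord0; rewrite ffunE unlift_none.
      by apply/forallP => k; have := H (lift ord0 k); rewrite ffunE liftK.
    by rewrite ffunE; case: unliftP => [k _|_ //]; exact: H.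
  case: ifPn => ac; last by apply: big1 => w _; rewrite cE (negbTE ac).
  rewrite -IH; last by apply: deck_perm_step.
  rewrite [RHS]big_mkcond; apply: eq_bigr => w _; rewrite cE ac/=.
  case: ifP => // _; congr (g (_ c)).
  rewrite /moves enum_ordSl/= ffunE unlift_none/=; congr foldl.
  by rewrite -map_comp; apply: eq_map => k /=; rewrite ffunE liftK.
transitivity (\sum_(a : 'I_n | val a != c) \sum_(p : 'I_n)
   (n%:R * (n%:R - 1)) ^+ t * iter t (stepop n) g (rtr_step a p pos c)).
  by rewrite pair_big; apply: eq_bigl => -[a p]; rewrite andbT.
under eq_bigr do rewrite -mulr_sumr.
by rewrite -mulr_sumr sum_rtr_step// exprSr mulrA.
Qed.

Lemma iter_stepop1 {R : realType} n t x : iter t (stepop n) (fun=> 1 : R) x = 1.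
Proof.
elim: t x => [//|t IH] x; rewrite iterS /stepop !IH; ring.
Qed.

(** [sum_rtr_run] for the constant 1 counts the conditioning event, so the powers cancel in the
    quotient. *)
Lemma cond_exp_rtr {R : realType} (n t c : nat) (g : nat -> R) :
  (1 < n)%N -> (c < n)%N ->
  cond_exp_unif (fun w : outcomes n t => notChosen w c)
    (fun w : outcomes n t => g (Pi w c)) = iter t (stepop n) g c.
Proof.
move=> n1 cn; have idP : deck_perm n (fun x => x) by split.
rewrite /cond_exp_unif /Pi /rtr_run sum_rtr_run//.
have := sum_rtr_run t (fun=> 1 : R) n1 cn idP.
rewrite iter_stepop1 mulr1 sumr_const => ->.
rewrite mulrAC divff ?mul1r//; apply/expf_neq0/mulf_neq0.
  by rewrite pnatr_eq0; lia.
by rewrite subr_eq0 (eqr_nat R n 1); lia.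
Qed.

(** * Drift and speed of the position chain *)

Section TrigBounds.
Context {R : realType}.
Implicit Types x : R.

Lemma norm_sin_le x : `|sin x| <= `|x|.
Proof.
wlog x0 : x / 0 <= x => [H|].
  have [/H //|/ltW x0] := leP 0 x.
  by rewrite -normrN -sinN -(normrN x); apply: H; rewrite oppr_ge0.
have dsin (y : R) : y \in `]0, x[ -> is_derive y (1 : R) sin (cos y).
  by move=> _; exact: is_derive_sin.
have csin : {within `[0, x], continuous (@sin R)}.
  by apply: continuous_subspaceT => y; exact: continuous_sin.
have [c _] := MVT_segment x0 dsin csin.
rewrite sin0 !subr0 => ->; rewrite normrM ler_piMl// cos_max //.
Qed.

Lemma onem_cosE x : 1 - cos x = 2 * sin (x / 2) ^+ 2.
Proof.
have {1}-> : x = (x / 2) *+ 2 by rewrite -mulr_natr divfK// (eqr_nat R 2 0).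
rewrite cos_mulr2n cos2sin2; lra.
Qed.

Lemma onem_cos_ge0 x : 0 <= 1 - cos x.
Proof. by rewrite subr_ge0 cos_le1. Qed.

Lemma onem_cos_le x : 1 - cos x <= x ^+ 2 / 2.
Proof.
rewrite onem_cosE; have := norm_sin_le (x / 2).
rewrite -ler_sqr ?nnegrE ?normr_ge0// !real_normK ?num_real//; lra.
Qed.

(** Mean value theorem for [y - sin y], whose derivative [1 - cos y] is at most [x ^+ 2 / 2] between
    0 and [x]. *)
Lemma norm_sin_sub x : `|x - sin x| <= `|x| ^+ 3 / 2.
Proof.
wlog x0 : x / 0 <= x => [H|].
  have [/H //|/ltW x0] := leP 0 x.
  rewrite -normrN opprB addrC -(opprK (sin x)) -sinN -(normrN x).
  by apply: H; rewrite oppr_ge0.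
have dh (y : R) : y \in `]0, x[ ->
    is_derive y (1 : R) (fun y => y - sin y) (1 - cos y).
  by move=> _; apply: trigger_derive.
have ch : {within `[0, x], continuous (fun y : R => y - sin y)}.
  apply: continuous_subspaceT => y; apply: cvgB; first exact: cvg_id.
  exact: continuous_sin.
have [c] := MVT_segment x0 dh ch.
rewrite sin0 !subr0 in_itv/= => /andP[c0 cx] ->.
rewrite normrM (ger0_norm (onem_cos_ge0 _)) (ger0_norm x0).
have := onem_cos_le c; have : c ^+ 2 <= x ^+ 2 by rewrite ler_sqr.
rewrite exprSr => h1 h2; have : 1 - cos c <= x ^+ 2 / 2 by lra.
by move=> /(ler_wpM2r x0); lra.
Qed.

Lemma norm_cos_taylor2 x : `|x ^+ 2 / 2 - (1 - cos x)| <= x ^+ 4 / 8.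
Proof.
rewrite onem_cosE.
(* With [y = x / 2] both terms are twice a square, and the difference of squares factors. *)
rewrite (_ : _ - _ = 2 * ((x / 2 - sin (x / 2)) * (x / 2 + sin (x / 2)))); last by field.
rewrite normrM normrM (@ger0_norm _ 2)//.
have := norm_sin_sub (x / 2); set y := x / 2 => h1.
have h2 : `|y + sin y| <= 2 * `|y|.
  by apply: le_trans (ler_normD _ _) _; have := norm_sin_le y; lra.
have := ler_pM (normr_ge0 _) (normr_ge0 _) h1 h2.
have -> : x ^+ 4 / 8 = 2 * (`|y| ^+ 4).
  have -> : `|y| ^+ 4 = y ^+ 4.
    by rewrite (exprM _ 2 2) real_normK ?num_real// -exprM.
  by rewrite /y; field.
have -> : `|y| ^+ 4 = `|y| ^+ 3 * `|y| by rewrite exprSr.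
by lra.
Qed.

(** The nontrivial side is exp(-x) <= 1 - x exp(-x) <= 1 - x + x^2, from
    [expR (- x) * (1 + x) <= 1]. *)
Lemma norm_expR_taylor1 x : 0 <= x -> `|1 - expR (- x) - x| <= x ^+ 2.
Proof.
move=> x0; rewrite ler_norml; have h1 := expR_ge1Dx (- x).
have h2 : expR (- x) * (1 + x) <= 1.
  rewrite expRN mulrC ler_pdivrMr ?expR_gt0// mul1r; exact: expR_ge1Dx.
have h3 : expR (- x) <= 1 by rewrite expR_le1 oppr_le0.
have := sqr_ge0 x; nra.
Qed.

End TrigBounds.

(** * Positivity, drift and speed of the transition operator *)

Section Stepop.
Context {R : realType} (n : nat).
Hypothesis n1 : (1 < n)%N.
Implicit Types (g h : nat -> R) (x : nat).
Let N : R := n%:R.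

Let N1 : 1 < N. Proof. by rewrite ltr1n. Qed.

(* Mean and mean square of the increment of the chain at position x. *)
Definition drift (x : R) := (N - 1 - 2 * x) / (N * (N - 1)).
Definition speed (x : R) := (2 * x * (N - 1 - x) + N - 1) / (N * (N - 1)).


Let N_neq0 : N != 0. Proof. by rewrite gt_eqF// (lt_trans ltr01 N1). Qed.
Let Nm1_neq0 : N - 1 != 0. Proof. by rewrite gt_eqF// subr_gt0. Qed.
Let NN1_gt0 : 0 < N * (N - 1).
Proof. by rewrite mulr_gt0 ?subr_gt0// (lt_trans ltr01 N1). Qed.

(** The down and up probabilities are half of speed minus drift and half of speed plus drift. *)
Lemma stepopE (G : R -> R) x :
  stepop n (fun x => G x%:R) x = G x%:R
  + (speed x%:R - drift x%:R) / 2 * (G (x%:R - 1) - G x%:R)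
  + (speed x%:R + drift x%:R) / 2 * (G (x%:R + 1) - G x%:R).
Proof.
rewrite /stepop -/N.
have eb : (N - 1 - x%:R) * (x%:R + 1) / (N * (N - 1)) = (speed x%:R + drift x%:R) / 2.
  by rewrite /speed /drift; field; exact/andP.
have ea : x%:R * (N - x%:R) / (N * (N - 1)) = (speed x%:R - drift x%:R) / 2.
  by rewrite /speed /drift; field; exact/andP.
(* At [x = 0] the down weight is zero, so the truncated predecessor 0 and the real number -1 may
   disagree. *)
rewrite eb ea natr1; case: x ea {eb} => [<-|x _]; first by rewrite !mul0r.
by have -> : x.+1%:R - 1 = x%:R :> R by rewrite -natr1 addrK.
Qed.

Lemma stepop_lin a b g h x :
  stepop n (fun x => a * g x + b * h x) x = a * stepop n g x + b * stepop n h x.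
Proof. rewrite /stepop; ring. Qed.

(** Below [n] the operator averages with nonnegative weights: [A] down, [B] up and [1 - A - B] for
    staying. At the last position [B] vanishes, so the chain does not leave the deck. *)
Lemma stepop_mono g h : (forall x, (x < n)%N -> g x <= h x) ->
  forall x, (x < n)%N -> stepop n g x <= stepop n h x.
Proof.
move=> gh x xn; rewrite -subr_ge0 /stepop -/N.
set A := x%:R * _ / _; set B := (_ - _ - _) * _ / _.
have xN : x%:R + 1 <= N by rewrite natr1 ler_nat.
have x0 : 0 <= x%:R :> R by [].
have A0 : 0 <= A by rewrite /A divr_ge0 ?(ltW NN1_gt0)// mulr_ge0//; lra.
have B0 : 0 <= B by rewrite /B divr_ge0 ?(ltW NN1_gt0)// mulr_ge0//; lra.
have AB : 0 <= 1 - A - B.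
  rewrite (_ : 1 - A - B = (x%:R ^+ 2 + (N - 1 - x%:R) ^+ 2) / (N * (N - 1))).
    by rewrite divr_ge0 ?(ltW NN1_gt0)// addr_ge0 ?sqr_ge0.
  by rewrite /A /B; field; exact/andP.
have gx : 0 <= h x - g x by rewrite subr_ge0 gh.
have gp : 0 <= h x.-1 - g x.-1 by rewrite subr_ge0 gh//; lia.
have gs : 0 <= B * (h x.+1 - g x.+1).
  have [xn'|nx] := ltnP x.+1 n; first by rewrite mulr_ge0// subr_ge0 gh.
  have -> : B = 0; last by rewrite mul0r.
  by rewrite /B (_ : N = x%:R + 1) ?addrK ?subrr ?mul0r// natr1 /N; congr _%:R; lia.
rewrite (_ : _ - _ = (1 - A - B) * (h x - g x) + A * (h x.-1 - g x.-1)
  + B * (h x.+1 - g x.+1)); last by ring.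
by rewrite !addr_ge0// mulr_ge0.
Qed.

Lemma iter_stepop_lin k a b g h x :
  iter k (stepop n) (fun x => a * g x + b * h x) x =
  a * iter k (stepop n) g x + b * iter k (stepop n) h x.
Proof.
elim: k x => [//|k IH] x.
by rewrite !iterS -stepop_lin; congr stepop; apply/funext.
Qed.

Lemma iter_stepop_mono k g h : (forall x, (x < n)%N -> g x <= h x) ->
  forall x, (x < n)%N -> iter k (stepop n) g x <= iter k (stepop n) h x.
Proof. by move=> gh; elim: k => [//|k IH] x xn; exact: stepop_mono. Qed.

Lemma norm_iter_stepop_le k g h : (forall x, (x < n)%N -> `|g x| <= h x) ->
  forall x, (x < n)%N -> `|iter k (stepop n) g x| <= iter k (stepop n) h x.
Proof.
move=> gh x xn; rewrite ler_norml; apply/andP; split; last first.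
  by apply: iter_stepop_mono => // y /gh; exact/le_trans/ler_norm.
have -> : - iter k (stepop n) h x =
    iter k (stepop n) (fun x => (-1) * h x + 0 * h x) x.
  by rewrite iter_stepop_lin mul0r addr0 mulN1r.
apply: iter_stepop_mono => // y /gh; rewrite ler_norml mul0r addr0 mulN1r.
by case/andP.
Qed.

Lemma norm_drift_le x : (x < n)%N -> `|drift x%:R| <= N^-1.
Proof.
move=> xn; have xN : x%:R + 1 <= N by rewrite natr1 ler_nat.
have x0 : 0 <= x%:R :> R by [].
rewrite /drift normrM normfV (gtr0_norm NN1_gt0) ler_pdivrMr//.
rewrite mulKf// ler_norml; lra.
Qed.

Lemma speed_near (j x : nat) : (0 < j <= n)%N -> (x < n)%N ->
  `|speed x%:R - 2 * (j%:R * (N - j%:R) / N ^+ 2)| <=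
  (2 * `|x%:R - (j%:R - 1)| + 1) / N.
Proof.
move=> /andP[j0 jn] xn; have xN : x%:R + 1 <= N by rewrite natr1 ler_nat.
have x0 : 0 <= x%:R :> R by [].
have jN : j%:R <= N by rewrite ler_nat.
have j1 : 1 <= j%:R :> R by rewrite ler1n.
(* Exact expansion about [j - 1]: since [|N - x - j| <= N - 1], the coefficient of the displacement
   is at most [2 / N] in modulus, and the remainder is at most [1 / N]. *)
have -> : speed x%:R - 2 * (j%:R * (N - j%:R) / N ^+ 2) =
   2 * ((x%:R - (j%:R - 1)) * ((N - x%:R - j%:R) / (N - 1))) / N
   + (1 - 2 * ((N - j%:R) ^+ 2 / (N * (N - 1)))) / N.
  by rewrite /speed; field; exact/andP.
have iN : `|N^-1| = N^-1 by rewrite ger0_norm// invr_ge0; lra.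
have iM : `|(N - 1)^-1| = (N - 1)^-1 by rewrite ger0_norm// invr_ge0; lra.
apply: le_trans (ler_normD _ _) _; rewrite [leRHS]mulrDl; apply: lerD.
  rewrite !normrM (@ger0_norm _ 2)// iN iM.
  rewrite -!mulrA; apply: ler_wpM2l => //; apply: ler_wpM2l => //.
  rewrite mulrA; apply: ler_piMl; first by rewrite invr_ge0; lra.
  by rewrite ler_pdivrMr ?subr_gt0// ler_norml; lra.
rewrite normrM iN; apply: ler_wpM2r; first by rewrite invr_ge0; lra.
have h : (N - j%:R) ^+ 2 / (N * (N - 1)) <= 1.
  by rewrite ler_pdivrMr// mul1r; nra.
have h0 : 0 <= (N - j%:R) ^+ 2 / (N * (N - 1)).
  by rewrite divr_ge0 ?sqr_ge0// ltW.
by rewrite ler_norml; lra.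
Qed.

End Stepop.

(** * Second moment and characteristic function of the displacement *)

Section ChainEstimates.
Context {R : realType} (n j t : nat) (lambda s : R).
Hypothesis n1 : (1 < n)%N.
Hypothesis jn : (0 < j <= n)%N.
Hypothesis t0 : (0 < t)%N.
Hypothesis s0 : 0 < s.
Hypothesis sE : s ^+ 2 = 2 * t%:R * lambda.
Let N : R := n%:R.
Let m : R := j%:R * (N - j%:R) / N ^+ 2.
Let Y (x : R) := x - (j%:R - 1).
Hypothesis slack : 6 * s / N + 2 * m + 1 / N <= 4 * lambda.

Let N_gt0 : 0 < N. Proof. by rewrite ltr0n ltnW. Qed.
Let t_gt0 : 0 < t%:R :> R. Proof. by rewrite ltr0n. Qed.
Let j1n : (j.-1 < n)%N. Proof. by case/andP: jn => *; lia. Qed.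
Let Yj : Y j.-1%:R = 0.
Proof.
case/andP: jn => j0 _; rewrite /Y -[in j%:R](prednK j0) -natr1; lra.
Qed.

Lemma lambda_gt0 : 0 < lambda.
Proof.
have : 0 < 2 * t%:R * lambda by rewrite -sE exprn_gt0.
by rewrite pmulr_rgt0// mulr_gt0.
Qed.

(** Arithmetic-geometric mean inequality at the scale [s]; trading [|Y|] for a quadratic lets the
    moment recursion close. *)
Let normY y : `|Y y| <= (s + Y y ^+ 2 / s) / 2.
Proof.
have -> : Y y ^+ 2 / s = (`|Y y| ^+ 2) / s by rewrite real_normK ?num_real.
rewrite -(ler_pM2r s0) [leRHS](_ : _ = (s ^+ 2 + `|Y y| ^+ 2) / 2); last first.
  by field; exact: lt0r_neq0.
by have := sqr_ge0 (s - `|Y y|); lra.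
Qed.

Let speed_near' x : (x < n)%N ->
  `|speed n x%:R - 2 * m| <= (s + Y x%:R ^+ 2 / s + 1) / N.
Proof.
move=> xn; apply: le_trans (speed_near n1 jn xn) _.
rewrite ler_pM2r ?invr_gt0//; have := normY x%:R; rewrite /Y; lra.
Qed.

(** While the mean square is at most [2 * s ^+ 2], one step increases it by at most the left-hand
    side of [slack], hence by at most [4 * lambda]; up to time [t] this growth preserves the bound
    [2 * s ^+ 2]. *)
Lemma second_moment k : (k <= t)%N ->
  iter k (stepop n) (fun x => Y x%:R ^+ 2) j.-1 <= k%:R * (4 * lambda).
Proof.
elim: k => [_|k IH kt]; first by rewrite /= Yj expr0n/= mul0r.
rewrite iterSr.
pose c1 := 1 + 2 / (s * N); pose c0 := 2 * s / N + 2 * m + 1 / N.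
apply: (@le_trans _ _ (iter k (stepop n) (fun x => c1 * Y x%:R ^+ 2 + c0 * 1) j.-1)).
  apply: iter_stepop_mono => // x xn.
  rewrite (stepopE n1 (fun y => Y y ^+ 2)).
  have -> : Y x%:R ^+ 2 +
     (speed n x%:R - drift n x%:R) / 2 * (Y (x%:R - 1) ^+ 2 - Y x%:R ^+ 2) +
     (speed n x%:R + drift n x%:R) / 2 * (Y (x%:R + 1) ^+ 2 - Y x%:R ^+ 2) =
     Y x%:R ^+ 2 + 2 * (Y x%:R * drift n x%:R) + speed n x%:R.
    by rewrite /Y; field.
  have h1 : Y x%:R * drift n x%:R <= `|Y x%:R| * N^-1.
    apply: le_trans (ler_norm _) _; rewrite normrM ler_wpM2l//.
    exact: norm_drift_le.
  have h2 := speed_near' xn; move: h2; rewrite ler_norml => /andP[_ h2].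
  have h3 : `|Y x%:R| * N^-1 <= (s + Y x%:R ^+ 2 / s) / 2 / N.
    by rewrite ler_pM2r ?invr_gt0.
  have -> : c1 * Y x%:R ^+ 2 + c0 * 1 = Y x%:R ^+ 2
     + 2 * ((s + Y x%:R ^+ 2 / s) / 2 / N)
     + ((s + Y x%:R ^+ 2 / s + 1) / N + 2 * m).
    by rewrite /c1 /c0; field; rewrite !gt_eqF.
  by lra.
rewrite iter_stepop_lin iter_stepop1.
set V := iter _ _ _ _.
have V1 : V <= k%:R * (4 * lambda) by apply: IH; exact: ltnW.
have l0 := lambda_gt0.
have V2 : V <= 2 * s ^+ 2.
  apply: le_trans V1 _; rewrite sE.
  have : k%:R <= t%:R :> R by rewrite ler_nat ltnW.
  by move=> /(ler_wpM2r (ltW l0)); lra.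
have e : 2 / (s * N) * V <= 4 * s / N.
  apply: le_trans (ler_wpM2l _ V2) _; first by rewrite divr_ge0// mulr_ge0// ltW.
  by rewrite le_eqVlt; apply/orP; left; apply/eqP; field; rewrite !gt_eqF.
have -> : c1 * V + c0 * 1 = V + 2 / (s * N) * V + c0 by rewrite /c1; ring.
by rewrite -natr1 mulrDl mul1r /c0; have := slack; lra.
Qed.

Lemma second_moment_le : iter t (stepop n) (fun x => Y x%:R ^+ 2) j.-1 <= 2 * s ^+ 2.
Proof. by apply: le_trans (second_moment (leqnn t)) _; rewrite sE; lra. Qed.

(** The one-step defect [stepop n h - r * h] is at most [a0 + a1 * Y ^+ 2]; the right-hand side is
    [t] times the mean of this bound, with [2 * s ^+ 2] for the mean of [Y ^+ 2]. *)
Lemma char_fun_near (u v : R) :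
  `|iter t (stepop n) (fun x => cos (u * (Y x%:R / s) + v)) j.-1
    - expR (- (u ^+ 2 / 2)) * cos v| <=
  u ^+ 4 / (4 * t%:R) + u ^+ 4 / (8 * s ^+ 2) + `|1 - m / lambda| * u ^+ 2 / 2
  + (3 * s + 1) * u ^+ 2 * t%:R / (2 * N * s ^+ 2) + t%:R * `|u| / (N * s).
Proof.
have l0 := lambda_gt0; have sn0 : s != 0 by rewrite gt_eqF.
have Nn0 : N != 0 by rewrite gt_eqF.
have tn0 : t%:R != 0 :> R by rewrite gt_eqF.
pose h (x : nat) := cos (u * (Y x%:R / s) + v).
(* [z] equals [u ^+ 2 / (2 * t)], so [r ^+ t] is exactly the Gaussian factor. *)
pose th := u / s; pose z := lambda * th ^+ 2; pose r := expR (- z).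
have th2 : 0 <= th ^+ 2 := sqr_ge0 _.
have z0 : 0 <= z by rewrite mulr_ge0// ltW.
have zt : z = u ^+ 2 / (2 * t%:R).
  rewrite /z /th expr_div_n sE; field; rewrite tn0/=; exact: lt0r_neq0.
have r1 : r <= 1 by rewrite expR_le1 oppr_le0.
(* In order: Taylor error of the exponential, Taylor error of the cosine, deviation of the speed
   from [2 * lambda], drift. [a1] is the part of the speed deviation that grows with the
   displacement. *)
pose a0 := z ^+ 2 + lambda * th ^+ 4 / 4
  + (2 * `|lambda - m| + (s + 1) / N) * th ^+ 2 / 2 + `|th| / N.
pose a1 := th ^+ 2 / (2 * N * s).
have step x : (x < n)%N -> `|stepop n h x + (- r) * h x| <= a0 * 1 + a1 * Y x%:R ^+ 2.
  move=> xn; rewrite mulr1 /h (stepopE n1 (fun y => cos (u * (Y y / s) + v))).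
  set y := u * (Y x%:R / s) + v.
  have -> : u * (Y (x%:R - 1) / s) + v = y - th by rewrite /y /Y /th; field.
  have -> : u * (Y (x%:R + 1) / s) + v = y + th by rewrite /y /Y /th; field.
  rewrite (cosB y th) (cosD y th); set q := speed _ _; set d := drift _ _.
  rewrite [X in `|X|](_ : _ = cos y * ((1 - r - z) + (z - 2 * lambda * (1 - cos th))
      + (2 * lambda - q) * (1 - cos th)) - d * (sin th * sin y)); last by field.
  apply: le_trans (ler_normB _ _) _; rewrite normrM.
  have hc : `|(1 - r - z) + (z - 2 * lambda * (1 - cos th))
      + (2 * lambda - q) * (1 - cos th)| <= z ^+ 2 + lambda * th ^+ 4 / 4
      + (2 * `|lambda - m| + (s + Y x%:R ^+ 2 / s + 1) / N) * (th ^+ 2 / 2).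
    apply: le_trans (ler_normD _ _) _; apply: lerD.
      apply: le_trans (ler_normD _ _) _; apply: lerD; first exact: norm_expR_taylor1.
      have -> : z - 2 * lambda * (1 - cos th) =
        2 * lambda * (th ^+ 2 / 2 - (1 - cos th)) by rewrite /z; field.
      rewrite normrM (@ger0_norm _ (2 * lambda)); last by lra.
      by have := ler_wpM2l (ltW l0) (norm_cos_taylor2 th); lra.
    rewrite normrM (ger0_norm (onem_cos_ge0 _)).
    apply: ler_pM; [exact: normr_ge0|exact: onem_cos_ge0| |exact: onem_cos_le].
    have -> : 2 * lambda - q = 2 * (lambda - m) - (q - 2 * m) by ring.
    apply: le_trans (ler_normB _ _) _; apply: lerD; last exact: speed_near'.
    by rewrite normrM ger0_norm.
  have hs : `|d * (sin th * sin y)| <= `|th| / N.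
    rewrite (mulrC d) (normrM (sin th * sin y)) (normrM (sin th)); apply: ler_pM => //.
      rewrite -[leRHS]mulr1; apply: ler_pM => //; [exact: norm_sin_le|exact: sin_max].
    exact: norm_drift_le.
  apply: (@le_trans _ _ (1 * (z ^+ 2 + lambda * th ^+ 4 / 4
      + (2 * `|lambda - m| + (s + Y x%:R ^+ 2 / s + 1) / N) * (th ^+ 2 / 2)) + `|th| / N)).
    apply: lerD => //; apply: ler_pM => //; exact: cos_max.
  rewrite le_eqVlt; apply/orP; left; apply/eqP; rewrite /a0 /a1.
  by field; rewrite ?Nn0 ?sn0.
pose err := a0 + a1 * (2 * s ^+ 2).
have a10 : 0 <= a1 by rewrite divr_ge0// !mulr_ge0// ltW.
have main k : (k <= t)%N ->
    `|iter k (stepop n) h j.-1 - r ^+ k * cos v| <= k%:R * err.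
  elim: k => [_|k IH kt].
    by rewrite /= /h Yj mul0r mulr0 add0r expr0 mul1r subrr normr0 mul0r.
  rewrite iterSr exprS -natr1 mulrDl mul1r [leRHS]addrC.
  (* The last step is peeled off: its defect is averaged over the position at time [k], and the
     earlier error is multiplied by [r <= 1]. *)
  rewrite (_ : _ - _ = (1 * iter k (stepop n) (stepop n h) j.-1
    + (- r) * iter k (stepop n) h j.-1)
    + r * (iter k (stepop n) h j.-1 - r ^+ k * cos v)); last by ring.
  apply: le_trans (ler_normD _ _) _; apply: lerD.
    rewrite -iter_stepop_lin.
    apply: (@le_trans _ _ (iter k (stepop n) (fun x => a0 * 1 + a1 * Y x%:R ^+ 2) j.-1)).
      by apply: norm_iter_stepop_le => // x xn; rewrite mul1r; exact: step.
    rewrite iter_stepop_lin iter_stepop1 mulr1 lerD2l; apply: ler_wpM2l => //.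
    apply: le_trans (second_moment (ltnW kt)) _.
    have : k%:R <= t%:R :> R by rewrite ler_nat ltnW.
    by move=> /(ler_wpM2r (ltW l0)); rewrite sE; lra.
  rewrite normrM (ger0_norm (expR_ge0 _)).
  apply: le_trans (IH (ltnW kt)); exact: ler_piMl.
have := main t (leqnn t).
have -> : r ^+ t = expR (- (u ^+ 2 / 2)).
  by rewrite /r -expRM_natl; congr expR; rewrite zt; field.
move/le_trans; apply; rewrite le_eqVlt; apply/orP; left; apply/eqP.
have -> : `|1 - m / lambda| = `|lambda - m| / lambda.
  rewrite -[X in _ = _ / X](gtr0_norm l0) -normf_div; congr (`|_|); field; exact: lt0r_neq0.
have thE : `|th| = `|u| / s by rewrite /th normf_div (gtr0_norm s0).
have lE : lambda = s ^+ 2 / (2 * t%:R) by rewrite sE; field.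
rewrite /err /a0 /a1 thE zt /th; set D := `|lambda - m|; rewrite lE.
by field; rewrite ?Nn0 ?tn0 ?sn0 //=.
Qed.

End ChainEstimates.

(** * Gaussian integrals *)

Section Gauss.
Context {R : realType}.
Notation mu := (@lebesgue_measure R).
Let phi : R -> R := normal_pdf 0 1.

Lemma normal_pdf01E (x : R) : phi x = normal_peak 1 * expR (- (x ^+ 2 / 2)).
Proof.
by rewrite /phi normal_pdfE ?oner_neq0// /normal_fun subr0 expr1n -[1 *+ 2]/(2 : R) mulNr.
Qed.

Lemma is_derive_normal_pdf01 (x : R) : is_derive x 1 phi (- (x * phi x)).
Proof.
have -> : phi = (fun x => normal_peak 1 * expR (- (x ^+ 2 / 2))).
  by apply/funext => y; rewrite normal_pdf01E.
apply: trigger_derive; rewrite /GRing.scale/=; lra.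
Qed.

Lemma normal_pdf01_ge0 x : 0 <= phi x. Proof. exact: normal_pdf_ge0. Qed.

Lemma continuous_normal_pdf01 : continuous phi.
Proof. exact/continuous_normal_pdf/oner_neq0. Qed.

(** Domination by the Gaussian density of standard deviation 2: [1 + x ^+ 2] is at most 8/3 exp(3
    x^2 / 8), and 3/8 = 1/2 - 1/8. *)
Lemma integrable_quad_normal_pdf (f : R -> R) (C : R) : measurable_fun setT f ->
  (forall x, `|f x| <= C * (1 + x ^+ 2)) ->
  mu.-integrable setT (EFin \o (fun x => f x * phi x)).
Proof.
move=> mf fC.
have C0 : 0 <= C by have := le_trans (normr_ge0 _) (fC 0); rewrite expr0n addr0 mulr1.
pose K : R := C * (8 / 3 * (normal_peak 1 / normal_peak 2)).
apply: (@le_integrable _ _ _ mu _ measurableT _ (fun x => K%:E * (normal_pdf 0 2 x)%:E)%E).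
- apply/measurable_EFinP/measurable_funM => //.
  exact: measurable_normal_pdf.
- move=> x _; rewrite /= lee_fin [leRHS]ger0_norm; last first.
    apply: mulr_ge0; last exact: normal_pdf_ge0.
    by rewrite !mulr_ge0 ?invr_ge0 ?normal_peak_ge0.
  rewrite normrM (ger0_norm (normal_pdf01_ge0 x)) normal_pdf01E.
  rewrite normal_pdfE ?(eqr_nat R 2 0)// /normal_fun subr0 /K.
  have p2 : normal_peak (2 : R) != 0.
    by rewrite gt_eqF// normal_peak_gt0// (eqr_nat R 2 0).
  rewrite [leRHS](_ : _ = C * (8 / 3 * expR (- x ^+ 2 / (2 ^+ 2 *+ 2))) * normal_peak 1); last first.
    by field.
  rewrite mulrA mulrAC; apply: ler_wpM2r; first exact: normal_peak_ge0.
  apply: le_trans (ler_wpM2r (expR_ge0 _) (fC x)) _.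
  rewrite -(mulrA C); apply: ler_wpM2l => //.
  rewrite [- x ^+ 2 / _](_ : _ = 3 / 8 * x ^+ 2 + - (x ^+ 2 / 2)); last by field.
  rewrite expRD mulrA; apply: ler_wpM2r; first exact: expR_ge0.
  have := expR_ge1Dx (3 / 8 * x ^+ 2); have := sqr_ge0 x; lra.
- apply: integrableZl => //; exact: integrable_normal_pdf.
Qed.

(** Fundamental theorem of calculus on growing symmetric intervals, then dominated convergence; the
    endpoints [n.+1] keep every interval nondegenerate. *)
Lemma Rintegral_derive_eq0 (F f : R -> R) :
  (forall x : R, is_derive x (1 : R) F (f x)) -> continuous f ->
  mu.-integrable setT (EFin \o f) ->
  F n%:R @[n --> \oo] --> 0 -> F (- n%:R) @[n --> \oo] --> 0 ->
  \int[mu]_x f x = 0.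
Proof.
move=> dF cf intf Fy FNy.
pose S (n : nat) : set R := `[- n.+1%:R, n.+1%:R]%classic.
pose fn n : R -> \bar R := (EFin \o f) \_ (S n).
have mS n : measurable (S n) by exact: measurable_itv.
have mf : measurable_fun setT (EFin \o f) by case/integrableP : intf.
have mfn n : measurable_fun setT (fn n).
  by apply/(measurable_restrictT _ (mS n)); exact: measurable_funS (@subsetT _ _) mf.
have fn_cvg : {ae mu, forall x, setT x -> fn ^~ x @ \oo --> (EFin \o f) x}.
  apply/aeW => x _; apply: cvg_near_cst; near=> n.
  rewrite /fn patchE mem_set// /S/= in_itv/= -ler_norml.
  have : `|x| <= n%:R by near: n; exact: nbhs_infty_ger.
  by move/le_trans; apply; rewrite ler_nat.
have fn_le : {ae mu, forall x n, setT x -> (`|fn n x| <= (EFin \o (Num.norm \o f)) x)%E}.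
  apply/aeW => x n _; rewrite /fn patchE; case: ifP => _ //=.
  by rewrite normr0 lee_fin.
have [_ _] := @dominated_convergence _ _ _ mu setT measurableT fn (EFin \o f)
  (EFin \o (Num.norm \o f)) mfn mf fn_cvg (integrable_norm intf) fn_le.
have fnE n : (\int[mu]_x fn n x = (F n.+1%:R - F (- n.+1%:R))%:E)%E.
  rewrite -integral_mkcond (@continuous_FTC2 _ _ F)// ?EFinB//.
  - by rewrite -subr_gt0 opprK -natrD ltr0n.
  - by apply: continuous_subspaceT.
  - have cF : continuous F.
      by move=> x; apply/differentiable_continuous/derivable1_diffP; case: (dF x).
    split=> [x _| |]; first by case: (dF x).
      exact/cvg_at_right_filter/cF.
    exact/cvg_at_left_filter/cF.
  - by move=> x _; rewrite derive1E derive_val.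
have h : (fun n => (\int[mu]_x fn n x)%E) @ \oo --> 0%:E.
  under eq_fun do rewrite fnE.
  apply: cvg_EFin; first by near=> n.
  rewrite -[X in _ --> X](subrr (0 : R)); apply: cvgB.
    by rewrite (cvg_shiftS (fun n => F n%:R)).
  by rewrite (cvg_shiftS (fun n => F (- n%:R))).
by move=> /(cvg_unique _ h) e; rewrite /Rintegral -e.
Unshelve. all: by end_near. Qed.


Definition gauss_mean (f : R -> R) : R := \int[mu]_x (f x * phi x).

Lemma continuous_cos_lin (u v : R) : continuous (fun x => cos (u * x + v)).
Proof.
move=> x; apply: continuous_comp; last exact: continuous_cos.
by apply: cvgD; [apply: cvgM; [exact: cvg_cst|exact: cvg_id]|exact: cvg_cst].
Qed.

Lemma continuous_sin_lin (u v : R) : continuous (fun x => sin (u * x + v)).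
Proof.
move=> x; apply: continuous_comp; last exact: continuous_sin.
by apply: cvgD; [apply: cvgM; [exact: cvg_cst|exact: cvg_id]|exact: cvg_cst].
Qed.

Lemma ler_norm_quad (x : R) : `|x| <= 1 + x ^+ 2.
Proof.
rewrite -(real_normK (num_real x)).
have := sqr_ge0 (`|x| - 1); have := normr_ge0 x; nra.
Qed.

Lemma integrable_xsin u v :
  mu.-integrable setT (EFin \o (fun x => x * sin (u * x + v) * phi x)).
Proof.
apply: (@integrable_quad_normal_pdf _ 1).
  apply: continuous_measurable_fun => x.
  by apply: cvgM; [exact: cvg_id|exact: continuous_sin_lin].
move=> x; rewrite normrM mul1r; apply: le_trans (ler_norm_quad x).
by rewrite ler_piMr// sin_max.
Qed.

Lemma integrable_cos u v :
  mu.-integrable setT (EFin \o (fun x => cos (u * x + v) * phi x)).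
Proof.
apply: (@integrable_quad_normal_pdf _ 1).
  by apply: continuous_measurable_fun; exact: continuous_cos_lin.
by move=> x; rewrite mul1r (le_trans (cos_max _))// lerDl sqr_ge0.
Qed.

Lemma cvg_bounded_normal_pdf01 (h : R -> R) (s : nat -> R) :
  (forall x, `|h x| <= 1) -> (forall n, `|s n| = n%:R) ->
  (fun n => h (s n) * phi (s n)) @ \oo --> 0.
Proof.
move=> h1 sn; apply/cvgr0Pnorm_le => e e0; near=> n.
have n0 : (0 < n%:R :> R) by near: n; exact: nbhs_infty_gtr.
rewrite normrM (ger0_norm (normal_pdf01_ge0 _)).
apply: le_trans (ler_wpM2r (normal_pdf01_ge0 _) (h1 _)) _; rewrite mul1r normal_pdf01E.
rewrite expRN -real_normK ?num_real// sn.
have ex : n%:R / 2 <= expR (n%:R ^+ 2 / 2 : R).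
  have := expR_ge1Dx (n%:R ^+ 2 / 2 : R); have := sqr_ge0 (n%:R - 1 : R); nra.
rewrite ler_pdivrMr ?expR_gt0//; apply: le_trans (ler_wpM2l (ltW e0) ex).
have : 2 * normal_peak 1 / e <= n%:R by near: n; exact: nbhs_infty_ger.
by rewrite ler_pdivrMr//; lra.
Unshelve. all: by end_near. Qed.

(** Gaussian integration by parts: the difference of the integrands is the derivative of
    [sin (u * x + v) * phi x], which vanishes at infinity. *)
Lemma gauss_mean_xsin u v :
  gauss_mean (fun x => x * sin (u * x + v)) = u * gauss_mean (fun x => cos (u * x + v)).
Proof.
rewrite /gauss_mean -RintegralZl//; last exact: integrable_cos.
apply/esym/eqP; rewrite -subr_eq0 -RintegralB//; last 2 first.
- exact: (integrableZl measurableT u (integrable_cos u v)).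
- exact: integrable_xsin.
apply/eqP; apply: (@Rintegral_derive_eq0 (fun x => sin (u * x + v) * phi x)).
- move=> x; have := is_derive_normal_pdf01 x => dphi.
  apply: trigger_derive; rewrite /GRing.scale/=; lra.
- move=> x; apply: cvgB; apply: cvgM; try exact: continuous_normal_pdf01.
  + exact: cvg_cst.
  + by apply: cvgM; [exact: continuous_cos_lin|exact: continuous_normal_pdf01].
  + by apply: cvgM; [exact: cvg_id|exact: continuous_sin_lin].
- exact: (integrableB measurableT
    (integrableZl measurableT u (integrable_cos u v)) (integrable_xsin u v)).
- apply: (@cvg_bounded_normal_pdf01 (fun x => sin (u * x + v)) (fun n => n%:R)) => [x|n].
    exact: sin_max.
  by rewrite normr_nat.
- apply: (@cvg_bounded_normal_pdf01 (fun x => sin (u * x + v)) (fun n => - n%:R)) => [x|n].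
    exact: sin_max.
  by rewrite normrN normr_nat.
Qed.

(** Differentiation under the integral, dominated by [|x| * phi x], and [gauss_mean_xsin] yield the
    equation G' = - u G. *)
Lemma is_derive_gauss_cos u v : is_derive u (1 : R)
  (fun u => gauss_mean (fun x => cos (u * x + v)))
  (- (u * gauss_mean (fun x => cos (u * x + v)))).
Proof.
pose F (s x : R) := cos (s * x + v) * phi x.
have dF s x : is_derive s (1 : R) (F ^~ x) (- (x * sin (s * x + v) * phi x)).
  apply: trigger_derive; rewrite /GRing.scale/=; lra.
have dFE s x : partial1of2 F s x = - (x * sin (s * x + v) * phi x).
  by rewrite partial1of2E derive_val.
have uI : `]u - 1, u + 1[%classic u by rewrite /= in_itv/= ltrBlDr !ltrDl ltr01.
have iF s : `]u - 1, u + 1[%classic s -> mu.-integrable setT (EFin \o F s).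
  by move=> _; exact: integrable_cos.
have derF s x : `]u - 1, u + 1[%classic s -> setT x -> derivable (F ^~ x) s 1.
  by move=> _ _; case: (dF s x).
have G0 x : 0 <= `|x| * phi x by rewrite mulr_ge0 ?normal_pdf01_ge0.
have iG : mu.-integrable setT (EFin \o (fun x => `|x| * phi x)).
  apply: (@integrable_quad_normal_pdf _ 1).
    by apply: continuous_measurable_fun; exact: norm_continuous.
  by move=> x; rewrite mul1r normr_id ler_norm_quad.
have Gub s x : `]u - 1, u + 1[%classic s -> setT x ->
    `|partial1of2 F s x| <= `|x| * phi x.
  move=> _ _; rewrite dFE normrN !normrM (ger0_norm (normal_pdf01_ge0 x)).
  by rewrite ler_wpM2r ?normal_pdf01_ge0// ler_piMr// sin_max.
have D := @derivable_under_integral _ _ _ mu F setT measurableT u (u - 1) (u + 1)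
  uI iF derF _ G0 iG Gub.
have := @differentiation_under_integral _ _ _ mu F setT measurableT u (u - 1) (u + 1)
  uI iF derF _ G0 iG Gub.
rewrite derive1E => DE; apply: DeriveDef; first exact: D.
rewrite [LHS]DE -gauss_mean_xsin /gauss_mean.
rewrite -mulN1r -RintegralZl//; last exact: integrable_xsin.
by apply: eq_Rintegral => x _; rewrite dFE mulN1r.
Qed.

(** The integrating factor exp(s^2 / 2) makes [H] constant, and [H 0] is [cos v] because the density
    has mass one. *)
Lemma gauss_mean_cos u v :
  gauss_mean (fun x => cos (u * x + v)) = expR (- (u ^+ 2 / 2)) * cos v.
Proof.
pose H (s : R) := gauss_mean (fun x => cos (s * x + v)) * expR (s ^+ 2 / 2).
have dH s : is_derive s (1 : R) H 0.
  have := is_derive_gauss_cos s v => dG.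
  apply: trigger_derive; rewrite /GRing.scale/=; lra.
have : H u = H 0 by exact: is_derive_0_is_cst.
rewrite /H expr0n/= mul0r expR0 mulr1 => /(canRL (mulfK _)) ->; last first.
  by rewrite gt_eqF// expR_gt0.
rewrite expRN mulrC; congr (_ * _).
rewrite /gauss_mean; under eq_Rintegral do rewrite mul0r add0r.
rewrite RintegralZl//; last exact: integrable_normal_pdf.
by rewrite /Rintegral integral_normal_pdf mulr1.
Qed.

(** The Radon-Nikodym derivative of [normal_prob] equals [phi] almost everywhere, as both have the
    same integral over every measurable set. *)
Lemma integral_normal_prob (f : R -> R) (M : R) : measurable_fun setT f ->
  (forall x, `|f x| <= M) ->
  (\int[normal_prob 0 1]_x (f x)%:E)%E = (gauss_mean f)%:E.
Proof.
move=> mf fM.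
have intf : (normal_prob 0 1).-integrable setT (EFin \o f).
  apply: measurable_bounded_integrable => //.
    by rewrite /= /normal_prob integral_normal_pdf ltry.
  by exists M; split; [exact: num_real|move=> y My x _; exact: le_trans (fM x) (ltW My)].
have ifphi : mu.-integrable setT (EFin \o (fun x => f x * phi x)).
  apply: (@integrable_quad_normal_pdf _ M) => // x; apply: le_trans (fM x) _.
  rewrite ler_peMr ?lerDl ?sqr_ge0//.
  exact: le_trans (normr_ge0 _) (fM 0).
pose P : probability _ R := @normal_prob R 0 1.
have dom : P `<< mu := @normal_prob_dominates R 0 1.
rewrite -(@Radon_Nikodym_change_of_variables _ _ _ P mu dom (EFin \o f) setT measurableT intf).
pose nu : {charge set _ -> \bar R} := charge_of_finite_measure P.
have iRN := @Radon_Nikodym_integrable _ _ _ nu mu dom.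
have aeRN : ae_eq mu setT
    (Radon_Nikodym nu mu) (EFin \o phi).
  apply: integral_ae_eq => //.
  - by apply/measurable_EFinP; exact: measurable_normal_pdf.
  - move=> A _ mA; by rewrite -(@Radon_Nikodym_integral _ _ _ nu mu A dom mA).
have -> : (gauss_mean f)%:E = (\int[mu]_x (f x * phi x)%:E)%E.
  by rewrite /gauss_mean /Rintegral fineK//; exact: integrable_fin_num.
apply: ae_eq_integral => //.
- apply: emeasurable_funM; first exact/measurable_EFinP.
  exact: measurable_int iRN.
- exact: measurable_int ifphi.
- apply: filterS aeRN => x /= h /h -> ; by rewrite EFinM.
Qed.

End Gauss.

(** * Approximation by trigonometric polynomials *)

Section Bernstein.
Context {R : realType}.
Implicit Types (y : R) (h : nat -> R).

(* bern N y h is the expectation of h under the binomial law of parameters N, y. *)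
Definition bern_step y h : nat -> R := fun k => (1 - y) * h k + y * h k.+1.
Definition bern (N : nat) y h : R := iter N (bern_step y) h 0%N.

Lemma bern_mono N y h h' : 0 <= y <= 1 -> (forall k, h k <= h' k) ->
  bern N y h <= bern N y h'.
Proof.
move=> /andP[y0 y1] hh; rewrite /bern.
elim: N 0%N => [|N IH] m /=; first exact: hh.
by apply: lerD; apply: ler_wpM2l; rewrite ?subr_ge0// IH.
Qed.

(** Squared bias plus variance of the binomial law. The induction covers all starting points [m],
    since a step may move to the successor. *)
Lemma bern_quad N y (A B a : R) :
  bern N y (fun k => A + B * (k%:R - a) ^+ 2) =
  A + B * ((N%:R * y - a) ^+ 2 + N%:R * (y * (1 - y))).
Proof.
suff H m : iter N (bern_step y) (fun k => A + B * (k%:R - a) ^+ 2) m =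
    A + B * ((m%:R + N%:R * y - a) ^+ 2 + N%:R * (y * (1 - y))).
  by rewrite /bern H add0r.
elim: N m => [|N IH] m; first by rewrite /= !mul0r !addr0.
rewrite iterS /bern_step !IH -!natr1; ring.
Qed.

(** Chebyshev argument: [g] lies between two parabolas centred at [y], whose binomial means are
    explicit. *)
Lemma bern_approx N (g : R -> R) y (A B : R) : 0 <= y <= 1 -> (0 < N)%N ->
  (forall z, `|g y - g z| <= A + B * (y - z) ^+ 2) -> 0 <= B ->
  `|g y - bern N y (fun k => g (k%:R / N%:R))| <= A + B / N%:R.
Proof.
move=> y01 N0 gyz B0; have Nn0 : N%:R != 0 :> R by rewrite pnatr_eq0; lia.
have qE (C D : R) : bern N y (fun k => C + D / N%:R ^+ 2 * (k%:R - N%:R * y) ^+ 2) =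
    C + D / N%:R * (y * (1 - y)).
  by rewrite bern_quad; field.
have y1 : B / N%:R * (y * (1 - y)) <= B / N%:R.
  apply: ler_piMr; first by rewrite divr_ge0.
  by case/andP: y01 => *; nra.
have yz k : (y - k%:R / N%:R) ^+ 2 = (k%:R - N%:R * y) ^+ 2 / N%:R ^+ 2.
  by field.
rewrite ler_distlC; apply/andP; split.
  have : bern N y (fun k => (g y - A) + (- B) / N%:R ^+ 2 * (k%:R - N%:R * y) ^+ 2)
     <= bern N y (fun k => g (k%:R / N%:R)).
    apply: bern_mono => // k; have := gyz (k%:R / N%:R); rewrite yz ler_norml; lra.
  rewrite qE; lra.
have : bern N y (fun k => g (k%:R / N%:R)) <=
    bern N y (fun k => (g y + A) + B / N%:R ^+ 2 * (k%:R - N%:R * y) ^+ 2).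
  apply: bern_mono => // k; have := gyz (k%:R / N%:R); rewrite yz ler_norml; lra.
rewrite qE; lra.
Qed.

Lemma norm_bern_le N y h M : 0 <= y <= 1 -> (forall k, `|h k| <= M) ->
  `|bern N y h| <= M.
Proof.
move=> y01 hM; have cE (C : R) : bern N y (fun=> C) = C.
  have := bern_quad N y C 0 0; rewrite mul0r addr0; apply: etrans.
  by congr bern; apply/funext => k; rewrite mul0r addr0.
rewrite ler_norml; apply/andP; split; [rewrite -[leLHS]cE|rewrite -[leRHS]cE];
  by apply: bern_mono => // k; have := hM k; rewrite ler_norml => /andP[].
Qed.

End Bernstein.

(** * Trigonometric polynomials and approximation with quadratic error *)

Section TrigPoly.
Context {R : realType}.

Inductive trig_poly : (R -> R) -> Prop :=
| trig_cos u v : trig_poly (fun x => cos (u * x + v))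
| trig_lin a b f g : trig_poly f -> trig_poly g ->
    trig_poly (fun x => a * f x + b * g x).

Lemma trig_poly_cst c : trig_poly (fun=> c).
Proof.
have := trig_lin c 0 (trig_cos 0 0) (trig_cos 0 0).
by under eq_fun do rewrite !mul0r !addr0 cos0 mulr1.
Qed.

(** Product-to-sum formula; the phase [pi / 2] turns the resulting sines into cosines. *)
Lemma trig_poly_mul_sin c f : trig_poly f -> trig_poly (fun x => sin (c * x) * f x).
Proof.
elim=> [u v|a b {}f g _ IHf _ IHg].
  have := trig_lin (1 / 2) (- (1 / 2)) (trig_cos (u - c) (v + pi / 2))
    (trig_cos (u + c) (v + pi / 2)).
  congr trig_poly; apply/funext => x.
  rewrite !addrA !cosDpihalf.
  rewrite (_ : (u - c) * x + v = (u * x + v) - c * x); last by ring.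
  rewrite (_ : (u + c) * x + v = (u * x + v) + c * x); last by ring.
  by rewrite (sinB (u * x + v)) (sinD (u * x + v)); field.
have := trig_lin a b IHf IHg; congr trig_poly; apply/funext => x; ring.
Qed.

Lemma trig_poly_bern c N h :
  trig_poly (fun x => bern N ((1 + sin (c * x)) / 2) h).
Proof.
suff H m : trig_poly (fun x => iter N (bern_step ((1 + sin (c * x)) / 2)) h m).
  exact: H.
elim: N m => [|N IH] m; first exact: trig_poly_cst.
have := trig_lin (1 / 2) (1 / 2) (trig_lin 1 (-1) (IH m) (trig_poly_mul_sin c (IH m)))
  (trig_lin 1 1 (IH m.+1) (trig_poly_mul_sin c (IH m.+1))).
congr trig_poly; apply/funext => x /=; set H := iter _ _ _.
by rewrite [bern_step _ H]/bern_step; field.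
Qed.

(** Heine-Cantor, with compactness in its near-covering form. *)
Lemma uniform_modulus (g : R -> R) (a e : R) :
  (forall x, -a <= x <= a -> {for x, continuous g}) -> 0 < e ->
  exists2 d : R, 0 < d & forall x y, -a <= x <= a -> -a <= y <= a ->
    `|x - y| < d -> `|g x - g y| <= e.
Proof.
move=> cg e0.
have := @segment_compact R (- a) a => /compact_near_coveringP cpt.
have := cpt R (0 : R)^'+ (fun d x => forall y, `|x - y| < d -> `|g x - g y| <= e) _.
case.
  move=> x; rewrite /= in_itv/= => /cg /cvgrPdist_le /(_ (e / 2)) [|r /= r0 rg].
    by rewrite divr_gt0.
  exists (ball x (r / 2), [set d | 0 < d < r / 2]).
    split; first by apply: nbhsx_ballx; rewrite divr_gt0.
    near=> d; apply/andP; split; first by near: d; exact: nbhs_right_gt.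
    by near: d; apply: nbhs_right_lt; rewrite divr_gt0.
  move=> [x' d]/= [xx' /andP[d0 dr]] y yd.
  have h1 : `|g x - g x'| <= e / 2.
    by apply: rg => /=; apply: lt_trans xx' _; lra.
  have h2 : `|g x - g y| <= e / 2.
    apply: rg; rewrite /= (_ : x - y = (x - x') + (x' - y)); last by ring.
    by apply: le_lt_trans (ler_normD _ _) _; move: xx'; rewrite /ball/=; lra.
  rewrite (_ : g x' - g y = (g x - g y) - (g x - g x')); last by ring.
  by apply: le_trans (ler_normB _ _) _; lra.
move=> d /= d0 H; exists (d / 2); first by rewrite divr_gt0.
move=> x y xa _ xy; apply: (H (d / 2)) => //=.
- rewrite sub0r normrN gtr0_norm ?divr_gt0//; lra.
- by rewrite divr_gt0.
Unshelve. all: by end_near. Qed.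

(** Keeps [[- sin 1, sin 1]] inside the open interval where [asin] is continuous. *)
Lemma sin1_lt1 : sin (1 : R) < 1.
Proof.
have := cos1_gt0 R; have := cos2Dsin2 (1 : R); have := sin_le1 (1 : R).
rewrite le_eqVlt => /predU1P[->|//]; nra.
Qed.

(* Bernstein polynomials in the variable (1 + sin (x / L)) / 2, which is
   injective on [-L, L]. *)
Lemma trig_poly_approx (f : R -> R) (M e K : R) : continuous f ->
  (forall x, `|f x| <= M) -> 0 < e -> 0 < K ->
  exists2 B, trig_poly B & forall x, `|f x - B x| <= e + K * x ^+ 2.
Proof.
move=> cf fM e0 K0.
have M0 : 0 <= M := le_trans (normr_ge0 _) (fM 0).
(* Ensures [2 * M <= K * L ^+ 2]: beyond [L] the trivial bound [2 * M] is absorbed by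
   [K * x ^+ 2]. *)
pose L : R := 1 + 2 * M / K.
have L1 : 1 <= L by rewrite lerDl divr_ge0// ?mulr_ge0// ltW.
have L0 : 0 < L by lra.
have LM : 2 * M <= K * L ^+ 2.
  have : 2 * M = K * (L - 1) by rewrite /L; field; rewrite gt_eqF.
  by move=> ->; apply: ler_wpM2l; [exact: ltW|nra].
pose a : R := sin 1.
have a1 : a < 1 := sin1_lt1.
have a0 : 0 <= a by rewrite /a ltW// sin2_gt0// ltr01 ltr1n.
pose G (z : R) := f (L * asin z).
have cG z : - a <= z <= a -> {for z, continuous G}.
  move=> /andP[az za]; apply: continuous_comp; last exact: cf.
  apply: cvgM; first exact: cvg_cst.
  by apply: continuous_asin; lra.
have [d d0 Gd] := uniform_modulus cG (divr_gt0 e0 (ltr0Sn R 1)).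
(* Clamping extends [G] beyond [[-a, a]] without losing its bound or its modulus, since [cl] is
   1-Lipschitz. *)
pose cl (z : R) := Num.max (- a) (Num.min z a).
have clP z : - a <= cl z <= a.
  rewrite /cl le_max lexx ge_max ge_min lexx orbT andbT /=; lra.
have clL z w : `|cl z - cl w| <= `|z - w|.
  wlog zw : z w / z <= w => [H|].
    by have [/H//|/ltW/H] := leP z w; rewrite distrC (distrC w).
  rewrite (distrC z) (ger0_norm (_ : 0 <= w - z)) ?subr_ge0//.
  rewrite /cl !maxEle !minEle ler_norml.
  by repeat case: ifPn; rewrite -?ltNge => *; lra.
pose g (y : R) := G (cl (2 * y - 1)).
(* Makes [D * (y - z) ^+ 2] at least [2 * M] once [|2 * (y - z)| >= d], where the modulus of
   continuity says nothing. *)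
pose D := 2 * M * 4 / d ^+ 2.
have D0 : 0 <= D by rewrite divr_ge0 ?sqr_ge0// !mulr_ge0.
have gM y : `|g y| <= M by exact: fM.
have gyz y z : `|g y - g z| <= e / 2 + D * (y - z) ^+ 2.
  have [dd|dd] := ltP `|2 * (y - z)| d.
    apply: (@le_trans _ _ (e / 2)); last by rewrite lerDl mulr_ge0// sqr_ge0.
    apply: Gd => //; apply: le_lt_trans (clL _ _) _.
    by rewrite (_ : _ - _ = 2 * (y - z)) //; ring.
  apply: (@le_trans _ _ (2 * M)).
    by apply: le_trans (ler_normB _ _) _; have := gM y; have := gM z; lra.
  suff : 2 * M <= D * (y - z) ^+ 2 by lra.
  have d2 : d ^+ 2 <= 4 * (y - z) ^+ 2.
    rewrite (_ : 4 * _ = `|2 * (y - z)| ^+ 2); last first.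
      by rewrite real_normK ?num_real//; ring.
    by rewrite ler_sqr ?nnegrE// ltW.
  rewrite /D [leRHS](_ : _ = 2 * M * (4 * (y - z) ^+ 2 / d ^+ 2)); last first.
    by field; rewrite gt_eqF.
  by rewrite ler_peMr ?mulr_ge0// ler_pdivlMr ?exprn_gt0// mul1r.
have [N N0 DN] : exists2 N, (0 < N)%N & D / N%:R <= e / 2.
  pose N := (Num.truncn (D * 2 / e)).+1; exists N => //.
  have DN : D * 2 / e <= N%:R by exact/ltW/truncnS_gt.
  rewrite ler_pdivrMr ?ltr0n//; move: DN; rewrite ler_pdivrMr//; lra.
pose y (x : R) := (1 + sin (L^-1 * x)) / 2.
have y01 x : 0 <= y x <= 1.
  have := sin_le1 (L^-1 * x); have := sin_geN1 (L^-1 * x).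
  by rewrite /y => *; apply/andP; split; lra.
exists (fun x => bern N (y x) (fun k => g (k%:R / N%:R))).
  exact: trig_poly_bern.
move=> x; have [xL|xL] := leP `|x| L.
  have fg : f x = g (y x).
    rewrite /g /y /G (_ : 2 * _ - 1 = sin (L^-1 * x)); last by field.
    have xL1 : -1 <= L^-1 * x <= 1.
      by rewrite -ler_norml normrM gtr0_norm ?invr_gt0// mulrC ler_pdivrMr// mul1r.
    have p1 : 1 <= pi / 2 :> R := pihalf_ge1 R.
    have sm : {in `[(- (pi / 2)), pi / 2] &, {mono (@sin R) : x y / x <= y}}.
      by apply: le_mono_in => ? ? ? ? ?; rewrite ltr_sin.
    have xin z : -1 <= z <= 1 -> z \in `[(- (pi / 2)), (pi / 2 : R)].
      by rewrite in_itv/=; lra.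
    have -> : cl (sin (L^-1 * x)) = sin (L^-1 * x).
      have h1 : sin (L^-1 * x) <= a by rewrite sm ?xin//; lra.
      have h2 : - a <= sin (L^-1 * x) by rewrite -sinN sm ?xin//; lra.
      by rewrite /cl min_l// max_r.
    by rewrite sinK ?xin// mulVKf// gt_eqF.
  rewrite fg; apply: le_trans (bern_approx (y01 x) N0 (gyz _) D0) _.
  by have := sqr_ge0 x; nra.
have h := norm_bern_le N (y01 x) (fun k => gM (k%:R / N%:R)).
apply: le_trans (ler_normB _ _) _; have := fM x.
have : L ^+ 2 <= x ^+ 2.
  by rewrite -(real_normK (num_real x)) ler_sqr ?nnegrE ?(ltW L0) ?(ltW xL).
move=> /(ler_wpM2l (ltW K0)); lra.
Qed.

End TrigPoly.

(** * Convergence to the Gaussian mean *)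

Section Weak.
Context {R : realType}.
Notation mu := (@lebesgue_measure R).

(** A class holding bounded continuous functions, trigonometric polynomials and the square, on which
    [gauss_mean] is linear and monotone. *)
Definition quad_growth (f : R -> R) :=
  measurable_fun setT f /\ exists C, forall x, `|f x| <= C * (1 + x ^+ 2).

Lemma quad_growth_integrable f : quad_growth f ->
  mu.-integrable setT (EFin \o (fun x => f x * normal_pdf 0 1 x)).
Proof. by move=> [mf [C fC]]; exact: integrable_quad_normal_pdf mf fC. Qed.

Lemma quad_growth_bounded f M : continuous f -> (forall x, `|f x| <= M) -> quad_growth f.
Proof.
move=> cf fM; split; first exact: continuous_measurable_fun.
exists M => x; apply: le_trans (fM x) _; rewrite ler_peMr ?lerDl ?sqr_ge0//.
exact: le_trans (normr_ge0 _) (fM 0).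
Qed.

Lemma quad_growth_quad (A B : R) : quad_growth (fun x => A + B * x ^+ 2).
Proof.
split.
  apply: continuous_measurable_fun => x; apply: cvgD; first exact: cvg_cst.
  by apply: cvgM; [exact: cvg_cst|exact: sqr_continuous].
exists (`|A| + `|B|) => x; apply: le_trans (ler_normD _ _) _.
rewrite normrM (ger0_norm (sqr_ge0 x)).
have := sqr_ge0 x; have := normr_ge0 A; have := normr_ge0 B; nra.
Qed.

Lemma quad_growth_lin a b f g : quad_growth f -> quad_growth g ->
  quad_growth (fun x => a * f x + b * g x).
Proof.
move=> [mf [C fC]] [mg [D gD]]; split.
  by apply: measurable_funD; apply: measurable_funM.
exists (`|a| * C + `|b| * D) => x.
apply: le_trans (ler_normD _ _) _; rewrite !normrM [leRHS]mulrDl -!mulrA.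
by apply: lerD; apply: ler_wpM2l.
Qed.

Lemma quad_growth_trig B : trig_poly B -> quad_growth B.
Proof.
elim=> [u v|a b f g _ qf _ qg]; last exact: quad_growth_lin.
apply: (@quad_growth_bounded _ 1) => [|x]; last exact: cos_max.
exact: continuous_cos_lin.
Qed.

Lemma gauss_mean_lin a b f g : quad_growth f -> quad_growth g ->
  gauss_mean (fun x => a * f x + b * g x) = a * gauss_mean f + b * gauss_mean g.
Proof.
move=> /quad_growth_integrable qf /quad_growth_integrable qg.
rewrite /gauss_mean -!RintegralZl// -RintegralD//.
- by apply: eq_Rintegral => x _; rewrite mulrDl !mulrA.
- exact: (integrableZl measurableT a qf).
- exact: (integrableZl measurableT b qg).
Qed.

Lemma gauss_mean_le f g : quad_growth f -> quad_growth g ->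
  (forall x, f x <= g x) -> gauss_mean f <= gauss_mean g.
Proof.
move=> /quad_growth_integrable qf /quad_growth_integrable qg fg.
by apply: le_Rintegral => // x _; rewrite ler_wpM2r ?normal_pdf_ge0.
Qed.

Lemma gauss_mean1 : gauss_mean (fun=> 1 : R) = 1.
Proof.
have := gauss_mean_cos (0 : R) 0.
under [X in gauss_mean X]eq_fun do rewrite mul0r addr0 cos0.
by move=> ->; rewrite expr0n/= mul0r oppr0 expR0 cos0 mulr1.
Qed.

(** Convergence passes from cosines to trigonometric polynomials by linearity, then to [f] by
    approximation, the quadratic error being controlled by second moments. *)
Lemma cvg_gauss_mean (E : nat -> (R -> R) -> R) (C : R) :
  (forall n a b f g, E n (fun x => a * f x + b * g x) = a * E n f + b * E n g) ->
  (forall n, E n (fun=> 1) = 1) ->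
  (\forall n \near \oo, forall f g, (forall x, f x <= g x) -> E n f <= E n g) ->
  (\forall n \near \oo, E n (fun x => x ^+ 2) <= C) ->
  (forall u v, (fun n => E n (fun x => cos (u * x + v))) @ \oo -->
    expR (- (u ^+ 2 / 2)) * cos v) ->
  forall f M, continuous f -> (forall x, `|f x| <= M) ->
  (fun n => E n f) @ \oo --> gauss_mean f.
Proof.
move=> Elin E1 Emono E2 Ecos f M cf fM.
have Etrig B : trig_poly B -> (fun n => E n B) @ \oo --> gauss_mean B.
  elim=> [u v|a b p q tp IHp tq IHq]; first by rewrite gauss_mean_cos.
  rewrite gauss_mean_lin; [|exact: quad_growth_trig..].
  under eq_fun do rewrite Elin.
  by apply: cvgD; apply: cvgM => //; exact: cvg_cst.
pose G2 := gauss_mean (fun x : R => x ^+ 2).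
have q1 : quad_growth (fun=> 1 : R).
  have := quad_growth_quad 1 0; congr quad_growth.
  by apply/funext => x; rewrite mul0r addr0.
have q2 : quad_growth (fun x : R => x ^+ 2).
  have := quad_growth_quad 0 1; congr quad_growth.
  by apply/funext => x; rewrite mul1r add0r.
(* One estimate for both [gauss_mean] and [E n]; the restriction to [quad_growth] is what Gaussian
   integrals require. *)
have close (F : (R -> R) -> R) (K e c : R) B :
    (forall a b g h, quad_growth g -> quad_growth h ->
      F (fun x => a * g x + b * h x) = a * F g + b * F h) ->
    F (fun=> 1) = 1 ->
    (forall g h, quad_growth g -> quad_growth h -> (forall x, g x <= h x) -> F g <= F h) ->
    F (fun x => x ^+ 2) <= c -> 0 <= K -> quad_growth B ->
    (forall x, `|f x - B x| <= e + K * x ^+ 2) -> `|F f - F B| <= e + K * c.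
  move=> Fl F1 Fm F2 K0 qB fB; have qf := quad_growth_bounded cf fM.
  have FfB : F f - F B = F (fun x => 1 * f x + (-1) * B x).
    by rewrite Fl// mul1r mulN1r.
  have Fq (a b : R) : F (fun x => a * 1 + b * x ^+ 2) = a + b * F (fun x => x ^+ 2).
    by rewrite (Fl a b (fun=> 1))// F1 mulr1.
  have h := ler_wpM2l K0 F2.
  rewrite FfB ler_norml; apply/andP; split.
    apply: (@le_trans _ _ (F (fun x => (- e) * 1 + (- K) * x ^+ 2))).
      by rewrite Fq; lra.
    apply: Fm; [exact: quad_growth_lin|exact: quad_growth_lin|move=> x].
    have := fB x; rewrite ler_norml; lra.
  apply: (@le_trans _ _ (F (fun x => e * 1 + K * x ^+ 2))).
    apply: Fm; [exact: quad_growth_lin|exact: quad_growth_lin|move=> x].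
    have := fB x; rewrite ler_norml; lra.
  by rewrite Fq; lra.
apply/cvgrPdist_le => e e0.
(* Makes [K * C] and [K * G2] at most [e / 8]; five errors of at most [e / 8] remain below [e]. *)
pose K := e / (8 * (`|C| + `|G2| + 1)).
have CG : 0 < `|C| + `|G2| + 1 by rewrite ltr_wpDl// addr_ge0.
have K0 : 0 < K by rewrite divr_gt0// mulr_gt0.
have e8 : 0 < e / 8 by rewrite divr_gt0.
have [B tB fB] := trig_poly_approx cf fM e8 K0.
have KC c : c <= `|C| + `|G2| + 1 -> K * c <= e / 8.
  move=> /(ler_wpM2l (ltW K0)); have -> : K * (`|C| + `|G2| + 1) = e / 8.
    by rewrite /K; field; rewrite gt_eqF.
  by [].
have hG : `|gauss_mean f - gauss_mean B| <= e / 8 + K * G2.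
  apply: close => //; [exact: gauss_mean_lin|exact: gauss_mean1|
    exact: gauss_mean_le|exact: ltW|exact: quad_growth_trig].
have KG : K * G2 <= e / 8.
  by apply: KC; have := ler_norm G2; have := normr_ge0 C; lra.
have KCC : K * C <= e / 8.
  by apply: KC; have := ler_norm C; have := normr_ge0 G2; lra.
have /cvgrPdist_le/(_ _ e8) Bn := Etrig B tB.
near=> n.
have hn : `|E n f - E n B| <= e / 8 + K * C.
  apply: close => //; [|by near: n|exact: ltW|exact: quad_growth_trig].
  by move=> g h _ _; move: g h; near: n.
have hB : `|gauss_mean B - E n B| <= e / 8 by near: n.
rewrite (_ : _ - _ = (gauss_mean f - gauss_mean B) + (gauss_mean B - E n B)
  - (E n f - E n B)); last by ring.
apply: le_trans (ler_normB _ _) _.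
have := ler_normD (gauss_mean f - gauss_mean B) (gauss_mean B - E n B).
lra.
Unshelve. all: by end_near. Qed.

End Weak.

(** * Consequences of the limit hypotheses *)

Section Asymptotics.
Context {R : realType} (j t : nat -> nat) (gamma : R).
Hypothesis jn : forall n, (0 < n)%N -> (0 < j n <= n)%N.
Hypothesis tj : \forall n \near \oo, (0 < t n)%N && (j n < n)%N.
Hypothesis jgamma : (fun n => (j n)%:R / n%:R : R) @ \oo --> gamma.
Hypothesis cvg1 :
  (fun n => (n%:R ^+ 2 / ((t n)%:R * (j n)%:R * (n - j n)%:R)) : R) @ \oo --> 0.
Hypothesis cvg2 :
  (fun n => ((t n)%:R / ((j n)%:R * (n - j n)%:R)) : R) @ \oo --> 0.

Let lambda (n : nat) : R :=
    if gamma == 0 then (j n)%:R / n%:R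
    else if gamma == 1 then (n - j n)%:R / n%:R
    else gamma * (1 - gamma).
Let m (n : nat) : R := (j n)%:R * (n%:R - (j n)%:R) / n%:R ^+ 2.
Let s (n : nat) : R := Num.sqrt (2 * (t n)%:R * lambda n).

Let good n := [/\ (0 < t n)%N, (0 < j n)%N & (j n < n)%N].

Lemma near_good : \forall n \near \oo, good n.
Proof.
near=> n; have /andP[tn jnn] : (0 < t n)%N && (j n < n)%N by near: n.
by split=> //; have /andP[] := jn (leq_ltn_trans (leq0n _) jnn).
Unshelve. all: by end_near. Qed.

Lemma cvg_m : m @ \oo --> gamma * (1 - gamma).
Proof.
have h : (fun n => ((j n)%:R / n%:R) * (1 - (j n)%:R / n%:R) : R) @ \oo -->
    gamma * (1 - gamma).
  by apply: cvgM => //; apply: cvgB => //; exact: cvg_cst.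
apply: cvg_trans h; apply: near_eq_cvg; near=> n.
have [_ _ jnn] : good n by near: n; exact: near_good.
by rewrite /m; field; rewrite pnatr_eq0; lia.
Unshelve. all: by end_near. Qed.

Let m_gt0 n : good n -> 0 < m n.
Proof.
move=> [_ j0 jnn]; rewrite divr_gt0 ?exprn_gt0 ?ltr0n//; last by lia.
by rewrite mulr_gt0 ?ltr0n// subr_gt0 ltr_nat.
Qed.

(** For large [n] the ratio is [1 - j / n] if [gamma] is 0 and [j / n] if it is 1; otherwise both
    quantities tend to the same nonzero limit. *)
Lemma cvg_m_lambda : (fun n => m n / lambda n) @ \oo --> (1 : R).
Proof.
rewrite /lambda; have [g0|g0] := eqVneq gamma 0.
  have h : (fun n => 1 - (j n)%:R / n%:R : R) @ \oo --> 1 - gamma.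
    by apply: cvgB => //; exact: cvg_cst.
  rewrite -[X in _ --> X]subr0 -g0; apply: cvg_trans h; apply: near_eq_cvg; near=> n.
  have [_ j0 jnn] : good n by near: n; exact: near_good.
  rewrite /m; field; rewrite !pnatr_eq0; lia.
have [g1|g1] := eqVneq gamma 1.
  rewrite -[X in _ --> X]g1; apply: cvg_trans jgamma; apply: near_eq_cvg; near=> n.
  have [_ j0 jnn] : good n by near: n; exact: near_good.
  rewrite /m natrB ?(ltnW jnn)//.
  have h : n%:R - (j n)%:R != 0 :> R by rewrite gt_eqF// subr_gt0 ltr_nat.
  by field; rewrite h pnatr_eq0; lia.
have g2 : gamma * (1 - gamma) != 0 by rewrite mulf_neq0// subr_eq0 eq_sym.
rewrite -[X in _ --> X](divff g2); apply: cvgM; [exact: cvg_m|exact: cvg_cst].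
Unshelve. all: by end_near. Qed.

(** Bounds [lambda] in the error term [u ^+ 4 / (4 * t)], rewritten as
    [u ^+ 4 * lambda / (2 * s ^+ 2)]. *)
Lemma cvg_lambda : exists l : R, lambda @ \oo --> l.
Proof.
rewrite /lambda; have [g0|g0] := eqVneq gamma 0; first by exists gamma.
have [g1|g1] := eqVneq gamma 1; last by eexists; exact: cvg_cst.
exists (1 - gamma).
have h : (fun n => 1 - (j n)%:R / n%:R : R) @ \oo --> 1 - gamma.
  by apply: cvgB => //; exact: cvg_cst.
apply: cvg_trans h; apply: near_eq_cvg; near=> n.
have [_ j0 jnn] : good n by near: n; exact: near_good.
rewrite natrB ?(ltnW jnn)//; field; rewrite pnatr_eq0; lia.
Unshelve. all: by end_near. Qed.

Lemma near_lambda_gt0 : \forall n \near \oo, 0 < lambda n.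
Proof.
near=> n; have gn : good n by near: n; exact: near_good.
have : 0 < m n / lambda n.
  by near: n; apply: (cvgr_gt _ cvg_m_lambda).
by rewrite pmulr_rgt0 ?m_gt0// invr_gt0.
Unshelve. all: by end_near. Qed.

Let s_facts n : good n -> 0 < lambda n ->
  [/\ 0 < s n, s n ^+ 2 = 2 * (t n)%:R * lambda n, 0 < n%:R :> R & 0 < (t n)%:R :> R].
Proof.
move=> [t0 j0 jnn] l0; have h : 0 < 2 * (t n)%:R * lambda n.
  by rewrite !mulr_gt0// ltr0n.
by split; rewrite ?sqrtr_gt0 ?sqr_sqrtr ?(ltW h) ?ltr0n//; lia.
Qed.

(** The square of [1 / s] is the quantity in [cvg1] times half of [m / lambda]. *)
Lemma cvg_sV : (fun n => (s n)^-1) @ \oo --> (0 : R).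
Proof.
have h : (fun n => Num.sqrt (n%:R ^+ 2 / ((t n)%:R * (j n)%:R * (n - j n)%:R)
    * (m n / lambda n) / 2)) @ \oo --> (0 : R).
  rewrite -[X in _ --> X]sqrtr0; apply: continuous_cvg; first exact: sqrt_continuous.
  rewrite -(mul0r (2^-1 : R)); apply: cvgM; last exact: cvg_cst.
  by rewrite -(mul0r (1 : R)); apply: cvgM => //; exact: cvg_m_lambda.
apply: cvg_trans h; apply: near_eq_cvg; near=> n.
have gn : good n by near: n; exact: near_good.
have l0 : 0 < lambda n by near: n; exact: near_lambda_gt0.
have [s0 sE n0 t0] := s_facts gn l0; have [_ j0 jnn] := gn.
rewrite [X in Num.sqrt X](_ : _ = (s n)^-1 ^+ 2).
  by rewrite sqrtr_sqr ger0_norm// invr_ge0 ltW.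
rewrite exprVn sE /m natrB ?(ltnW jnn)//.
have h1 : n%:R - (j n)%:R != 0 :> R by rewrite gt_eqF// subr_gt0 ltr_nat.
have h2 : (j n)%:R != 0 :> R by rewrite pnatr_eq0; lia.
by field; rewrite h1 h2 !gt_eqF.
Unshelve. all: by end_near. Qed.

(** [t / n] bounds the accumulated drift, which is thus negligible at scale [s]. The square is the
    quantity in [cvg2] times half of [m / lambda]. *)
Lemma cvg_tns : (fun n => (t n)%:R / (n%:R * s n)) @ \oo --> (0 : R).
Proof.
have h : (fun n => Num.sqrt ((t n)%:R / ((j n)%:R * (n - j n)%:R)
    * (m n / lambda n) / 2)) @ \oo --> (0 : R).
  rewrite -[X in _ --> X]sqrtr0; apply: continuous_cvg; first exact: sqrt_continuous.
  rewrite -(mul0r (2^-1 : R)); apply: cvgM; last exact: cvg_cst.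
  by rewrite -(mul0r (1 : R)); apply: cvgM => //; exact: cvg_m_lambda.
apply: cvg_trans h; apply: near_eq_cvg; near=> n.
have gn : good n by near: n; exact: near_good.
have l0 : 0 < lambda n by near: n; exact: near_lambda_gt0.
have [s0 sE n0 t0] := s_facts gn l0; have [_ j0 jnn] := gn.
rewrite [X in Num.sqrt X](_ : _ = ((t n)%:R / (n%:R * s n)) ^+ 2).
  by rewrite sqrtr_sqr ger0_norm// divr_ge0// ?mulr_ge0// ltW.
rewrite expr_div_n exprMn sE /m natrB ?(ltnW jnn)//.
have h1 : n%:R - (j n)%:R != 0 :> R by rewrite gt_eqF// subr_gt0 ltr_nat.
have h2 : (j n)%:R != 0 :> R by rewrite pnatr_eq0; lia.
by field; rewrite h1 h2 !gt_eqF.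
Unshelve. all: by end_near. Qed.

(** After division by [lambda = s ^+ 2 / (2 * t)] the left-hand side tends to 2, strictly below
    4. *)
Lemma near_slack :
  \forall n \near \oo, 6 * s n / n%:R + 2 * m n + 1 / n%:R <= 4 * lambda n.
Proof.
pose A n := (t n)%:R / (n%:R * s n).
have h : (fun n => 12 * A n + 2 * (m n / lambda n) + 2 * (A n * (s n)^-1)) @ \oo -->
    (12 * 0 + 2 * 1 + 2 * (0 * 0) : R).
  apply: cvgD; first apply: cvgD.
  - by apply: cvgM; [exact: cvg_cst|exact: cvg_tns].
  - by apply: cvgM; [exact: cvg_cst|exact: cvg_m_lambda].
  - apply: cvgM; first exact: cvg_cst.
    by apply: cvgM; [exact: cvg_tns|exact: cvg_sV].
near=> n.
have gn : good n by near: n; exact: near_good.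
have l0 : 0 < lambda n by near: n; exact: near_lambda_gt0.
have [s0 sE n0 t0] := s_facts gn l0.
have : 12 * A n + 2 * (m n / lambda n) + 2 * (A n * (s n)^-1) <= 4.
  by near: n; apply: (cvgr_le _ h); rewrite !(mulr0, mulr1, add0r, addr0) ltr_nat.
rewrite -(ler_pM2r l0); congr (_ <= _).
have lE : lambda n = s n ^+ 2 / (2 * (t n)%:R) by rewrite sE; field; rewrite gt_eqF.
rewrite /A; have -> : 2 * (m n / lambda n) = 2 * m n / lambda n by rewrite mulrA.
rewrite !mulrDl divfK ?gt_eqF// lE; field.
by rewrite !gt_eqF.
Unshelve. all: by end_near. Qed.

Lemma cvg_char_fun (u v : R) :
  (fun n => iter (t n) (stepop n)
     (fun x => cos (u * ((x%:R - ((j n)%:R - 1)) / s n) + v)) (j n).-1) @ \oo -->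
  expR (- (u ^+ 2 / 2)) * cos v.
Proof.
pose A n := (t n)%:R / (n%:R * s n).
have [l cl] := cvg_lambda.
(* The bound of [char_fun_near], rewritten in quantities with known limits. *)
pose bound n := u ^+ 4 / 2 * (lambda n * ((s n)^-1 * (s n)^-1))
  + u ^+ 4 / 8 * ((s n)^-1 * (s n)^-1)
  + u ^+ 2 / 2 * `|1 - m n / lambda n|
  + u ^+ 2 / 2 * (3 * A n + A n * (s n)^-1) + A n * `|u|.
have cbound : bound @ \oo --> (0 : R).
  have -> : 0 = u ^+ 4 / 2 * (l * (0 * 0)) + u ^+ 4 / 8 * (0 * 0)
      + u ^+ 2 / 2 * `|1 - 1| + u ^+ 2 / 2 * (3 * 0 + 0 * 0) + 0 * `|u| :> R.
    by rewrite subrr normr0; ring.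
  have cA : A @ \oo --> (0 : R) := cvg_tns.
  have cs := cvg_sV.
  have css : (fun n => (s n)^-1 * (s n)^-1) @ \oo --> (0 * 0 : R) by exact: cvgM.
  have cr : (fun n => `|1 - m n / lambda n|) @ \oo --> (`|1 - 1| : R).
    by apply: cvg_norm; apply: cvgB; [exact: cvg_cst|exact: cvg_m_lambda].
  apply: cvgD; last by apply: cvgM => //; exact: cvg_cst.
  apply: cvgD; last first.
    apply: cvgM; first exact: cvg_cst.
    by apply: cvgD; [apply: cvgM => //; exact: cvg_cst|exact: cvgM].
  apply: cvgD; last by apply: cvgM => //; exact: cvg_cst.
  apply: cvgD.
    by apply: cvgM; [exact: cvg_cst|exact: cvgM].
  by apply: cvgM => //; exact: cvg_cst.
apply/cvgrPdist_le => e e0.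
have /cvgr0_norm_le/(_ e e0) be := cbound; near=> n.
have gn : good n by near: n; exact: near_good.
have l0 : 0 < lambda n by near: n; exact: near_lambda_gt0.
have [s0 sE n0 t0] := s_facts gn l0; have [tn j0 jnn] := gn.
have n1 : (1 < n)%N by lia.
have jn' : (0 < j n <= n)%N by rewrite j0 ltnW.
have sl : 6 * s n / n%:R + 2 * m n + 1 / n%:R <= 4 * lambda n.
  by near: n; exact: near_slack.
have := char_fun_near n1 jn' tn s0 sE sl u v.
rewrite distrC => /le_trans; apply.
apply: (@le_trans _ _ (bound n)); last first.
  have := ler_norm (bound n); move/le_trans; apply.
  by near: n.
rewrite le_eqVlt; apply/orP; left; apply/eqP; rewrite /bound.
rewrite -/(m n); set D := `|_ - _|.
have lE : lambda n = s n ^+ 2 / (2 * (t n)%:R) by rewrite sE; field; rewrite gt_eqF.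
rewrite lE /A; field; by rewrite !gt_eqF.
Unshelve. all: by end_near. Qed.

Lemma near_second_moment : \forall n \near \oo,
  iter (t n) (stepop n) (fun x => ((x%:R - ((j n)%:R - 1)) / s n) ^+ 2) (j n).-1
    <= (2 : R).
Proof.
near=> n.
have gn : good n by near: n; exact: near_good.
have l0 : 0 < lambda n by near: n; exact: near_lambda_gt0.
have [s0 sE n0 t0] := s_facts gn l0; have [tn j0 jnn] := gn.
have n1 : (1 < n)%N by lia.
have jn' : (0 < j n <= n)%N by rewrite j0 ltnW.
have sl : 6 * s n / n%:R + 2 * m n + 1 / n%:R <= 4 * lambda n.
  by near: n; exact: near_slack.
have := second_moment_le n1 jn' tn s0 sE sl.
have -> : (fun x : nat => ((x%:R - ((j n)%:R - 1)) / s n) ^+ 2) =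
    (fun x => (s n ^- 2) * (x%:R - ((j n)%:R - 1)) ^+ 2 + 0 * 0).
  by apply/funext => x; rewrite mul0r addr0 expr_div_n mulrC.
rewrite (iter_stepop_lin _ _ _ _ _ (fun=> 0)) mul0r addr0 => h.
by rewrite mulrC ler_pdivrMr// exprn_gt0.
Unshelve. all: by end_near. Qed.

End Asymptotics.

(** * Weak convergence of the rescaled position *)

Theorem theorem2 (R : realType) (j t : nat -> nat) (gamma : R) :
  (forall n, (0 < n)%N -> (0 < j n <= n)%N) ->
  (\forall n \near \oo, (0 < t n)%N && (j n < n)%N) ->
  (fun n => (j n)%:R / n%:R : R) @ \oo --> gamma ->
  (fun n => (n%:R ^+ 2 / ((t n)%:R * (j n)%:R * (n - j n)%:R)) : R) @ \oo --> 0 ->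
  (fun n => ((t n)%:R / ((j n)%:R * (n - j n)%:R)) : R) @ \oo --> 0 ->
  let lambda (n : nat) : R :=
    if gamma == 0 then (j n)%:R / n%:R
    else if gamma == 1 then (n - j n)%:R / n%:R
    else gamma * (1 - gamma) in
  forall f : R -> R, continuous f -> (exists M : R, forall x, `|f x| <= M) ->
  (fun n => (cond_exp_unif
       (fun w : outcomes n (t n) => notChosen w (j n).-1)
       (fun w : outcomes n (t n) =>
          f (((Pi w (j n).-1)%:R + 1 - (j n)%:R)
             / Num.sqrt (2 * (t n)%:R * lambda n))))%:E)
    @ \oo --> (\int[normal_prob 0 1]_x (f x)%:E)%E.
Proof.
move=> jn tj jgamma cvg1 cvg2 lambda f cf [M fM].
rewrite (integral_normal_prob (continuous_measurable_fun cf) fM).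
apply: cvg_EFin; first exact: nearW.
pose s n := Num.sqrt (2 * (t n)%:R * lambda n).
(* Positions count from 0 and the chain starts at [j - 1], so the displacement [x - (j - 1)] is the
   [Pi + 1 - j] of the statement. *)
pose E n (g : R -> R) := iter (t n) (stepop n)
  (fun x => g ((x%:R - ((j n)%:R - 1)) / s n)) (j n).-1.
have EM : (fun n => E n f) @ \oo --> gauss_mean f.
  apply: (@cvg_gauss_mean _ E 2) cf fM.
  - by move=> n a b g h; rewrite /E iter_stepop_lin.
  - by move=> n; rewrite /E iter_stepop1.
  - near=> n; have [_ j0 jnn] : [/\ (0 < t n)%N, (0 < j n)%N & (j n < n)%N].
      by near: n; exact: near_good.
    by move=> g h gh; apply: iter_stepop_mono => //; lia.
  - exact: near_second_moment jn tj jgamma cvg1 cvg2.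
  - exact: cvg_char_fun jn tj jgamma cvg1 cvg2.
apply: cvg_trans EM; apply: near_eq_cvg; near=> n.
have [_ j0 jnn] : [/\ (0 < t n)%N, (0 < j n)%N & (j n < n)%N].
  by near: n; exact: near_good.
rewrite /E -cond_exp_rtr//=; try lia.
congr cond_exp_unif; apply/funext => w; congr (f (_ / _)); ring.
Unshelve. all: by end_near. Qed.
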